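(* Suppose that the level set $\mathcal{X}:=\{x\in\mathrm{dom}(F):F(x)\leq F(x^0)\}$ is compact. Then any accumulation point of the sequence $\{x^k:k\in\mathbb{N}\}$ generated by the algorithm AMPDA falls into the level set $\mathcal{X}$ and is a critical point of $F$.
   Context: Setting: $f,g:\mathbb{R}^n\to[0,+\infty)$ and $h:\mathbb{R}^n\to\mathbb{R}$ are proper closed (lower semicontinuous), $\mathcal{C}\subseteq\mathbb{R}^n$ is closed, $\Omega:=\{x\in\mathbb{R}^n: g(x)\neq 0\}$, and $\mathcal{C}\cap\Omega\neq\emptyset$. Standing assumptions: (i) $f$ is locally Lipschitz continuous on $\Omega$; (ii) $g$ is convex on $\mathbb{R}^n$; (iii) $h=h_1-h_2$, where $h_1:\mathbb{R}^n\to\mathbb{R}$ is locally Lipschitz differentiable around each $x\in\Omega$ (each $x\in\Omega$ has a ball on which $h_1$ is continuously differentiable with Lipschitz gradient) and $h_2:\mathbb{R}^n\to\mathbb{R}$ is convex; (iv) the proximal operator of $f_{\mathcal{C}}$ can be evaluated, where $f_{\mathcal{C}}:=f+\iota_{\mathcal{C}}$ and $\iota_{\mathcal{C}}$ is $0$ on $\mathcal{C}$, $+\infty$ elsewhere. Notation: $\mathbb{N}$ is the set of nonnegative integers. $F(x)=f(x)/g(x)+h(x)$ if $x\in\Omega\cap\mathcal{C}$, $F(x)=+\infty$ otherwise. $\mathrm{prox}_{\varphi}(x):=\arg\min\{\varphi(z)+\frac12\|x-z\|_2^2:z\in\mathbb{R}^n\}$ (a set). $\partial g,\partial h_2$ are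 convex subdifferentials; $g^*,h_2^*$ are convex conjugates. The function $Q:\mathbb{R}^n\times\mathbb{R}^n\times\mathbb{R}^n\times\mathbb{R}\to(-\infty,+\infty]$ is $$Q(x,y,z,c)=\iota_{\mathcal{C}}(x)+2cf(x)+c^2f(x)(g^*(y)-\langle x,y\rangle)+h_1(x)+h_2^*(z)-\langle x,z\rangle$$ if $(y,z)\in\mathrm{dom}(g^* )\times\mathrm{dom}(h_2^* )$, and $+\infty$ otherwise. Algorithm AMPDA. Step 0: input $x^0\in\mathrm{dom}(F)$, $0<\underline{\alpha}\leq\overline{\alpha}$, $\sigma>0$, $0<\gamma<1$; set $k=0$. Step 1: compute $c_k=1/g(x^k)$; choose any $(y^k,z^k)\in\partial g(x^k)\times\partial h_2(x^k)$; set $\alpha:=\widetilde{\alpha}_k$ for some $\widetilde{\alpha}_k\in[\underline{\alpha},\overline{\alpha}]$. Step 2: compute any $$\widehat{x}^k\in\mathrm{prox}_{\alpha c_kf_{\mathcal{C}}}\big(x^k-\alpha(\nabla h_1(x^k)-z^k-c_k^2f(x^k)y^k)\big).$$ If $\widehat{x}^k\in\Omega$ and $Q(\widehat{x}^k,y^k,z^k,1/g(\widehat{x}^k))+\frac{\sigma}{2}\|\widehat{x}^k-x^k\|_2^2\leq F(x^k)$, then set $x^{k+1}=\widehat{x}^k$ and go to Step 3; else set $\alpha:=\alpha\gamma$ and repeat Step 2. Step 3: record $\alpha_k:=\alpha$, set $k\leftarrow k+1$, and go to Step 1. Critical point: $x^{\star}\in\Omega$ is a critical point of $F$ if, with $c_{\star}=1/g(x^{\star})$,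 $$0\in\widehat{\partial}(c_{\star}f+\iota_{\mathcal{C}})(x^{\star})-c_{\star}^2f(x^{\star})\,\partial g(x^{\star})+\nabla h_1(x^{\star})-\partial h_2(x^{\star}),$$ where $\widehat{\partial}\varphi(x):=\{y:\liminf_{z\to x,z\neq x}\frac{\varphi(z)-\varphi(x)-\langle y,z-x\rangle}{\|z-x\|_2}\geq0\}$ for $x\in\mathrm{dom}(\varphi)$ (and $\emptyset$ otherwise) is the Fréchet subdifferential. *)

(* Defs.v *)
From HB Require Import structures.
From mathcomp Require Import all_boot all_order all_algebra.
From mathcomp Require Import all_classical all_reals all_analysis.

Set Implicit Arguments.
Unset Strict Implicit.
Unset Printing Implicit Defensive.

Import Order.TTheory GRing.Theory Num.Theory.
Import numFieldNormedType.Exports.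

Local Open Scope classical_set_scope.
Local Open Scope ring_scope.

(* R^n is 'rV[R]_n.  The norm the library puts on it is the sup norm; it is
   used below only through the topology and in local Lipschitz conditions,
   neither of which depends on the choice of a norm.  Wherever the value of
   the norm matters, the Euclidean norm enorm is used. *)

Definition dot (R : realType) (n : nat) (x y : 'rV[R]_n) : R :=
  \sum_(i < n) x ord0 i * y ord0 i.

Definition enorm (R : realType) (n : nat) (x : 'rV[R]_n) : R :=
  Num.sqrt (dot x x).

Definition grad (R : realType) (n : nat) (p : 'rV[R]_n -> R) (x : 'rV[R]_n)
    : 'rV[R]_n :=
  \row_(i < n) 'D_(delta_mx ord0 i) (p : 'rV[R]_n -> R^o) x.

Definition convex_on_Rn (R : realType) (n : nat) (p : 'rV[R]_n -> R) : Prop :=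
  @convex_function R 'rV[R]_n [set: 'rV[R]_n] p.

Definition locally_lipschitz_on (R : realType) (n : nat) (A : set 'rV[R]_n)
    (p : 'rV[R]_n -> R) : Prop :=
  forall x, A x -> exists2 r : R, 0 < r &
    [lipschitz (p y : R^o) | y in ball x r `&` A].

Definition locally_lipschitz_differentiable_on (R : realType) (n : nat)
    (A : set 'rV[R]_n) (p : 'rV[R]_n -> R) : Prop :=
  forall x, A x -> exists2 r : R, 0 < r &
    [/\ (forall y, ball x r y -> differentiable (p : 'rV[R]_n -> R^o) y),
        (forall y, ball x r y -> {for y, continuous (grad p)}) &
        [lipschitz (grad p y) | y in ball x r]].

(* Functions with values in (-oo, +oo] are represented in \bar R. *)

Definition edom (R : realType) (n : nat) (p : 'rV[R]_n -> \bar R)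
    : set 'rV[R]_n :=
  [set x | (p x < +oo)%E].

Definition iota_set (R : realType) (n : nat) (C : set 'rV[R]_n)
    (x : 'rV[R]_n) : \bar R :=
  if x \in C then 0%E else +oo%E.

Definition conjugate (R : realType) (n : nat) (p : 'rV[R]_n -> R)
    (y : 'rV[R]_n) : \bar R :=
  ereal_sup [set (dot x y - p x)%:E | x in [set: 'rV[R]_n]].

Definition convex_subdiff (R : realType) (n : nat) (p : 'rV[R]_n -> R)
    (x : 'rV[R]_n) : set 'rV[R]_n :=
  [set y | forall z, p x + dot y (z - x) <= p z].

Definition frechet_subdiff (R : realType) (n : nat) (p : 'rV[R]_n -> \bar R)
    (x : 'rV[R]_n) : set 'rV[R]_n :=
  [set y | edom p x /\
    (0 <= limf_einf
       (fun z => (p z - p x - (dot y (z - x))%:E) * ((enorm (z - x))^-1)%:E)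
       x^')%E].

Definition prox (R : realType) (n : nat) (p : 'rV[R]_n -> \bar R)
    (x : 'rV[R]_n) : set 'rV[R]_n :=
  [set z | forall u, (p z + (2^-1 * enorm (x - z) ^+ 2)%:E
                      <= p u + (2^-1 * enorm (x - u) ^+ 2)%:E)%E].

Definition Omega (R : realType) (n : nat) (g : 'rV[R]_n -> R)
    : set 'rV[R]_n :=
  [set x | g x != 0].

Definition restrict_to (R : realType) (n : nat) (f : 'rV[R]_n -> R)
    (C : set 'rV[R]_n) (x : 'rV[R]_n) : \bar R :=
  ((f x)%:E + iota_set C x)%E.

Definition objective (R : realType) (n : nat) (f g h : 'rV[R]_n -> R)
    (C : set 'rV[R]_n) (x : 'rV[R]_n) : \bar R :=
  if x \in Omega g `&` C then (f x / g x + h x)%:E else +oo%E.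

Definition level_set (R : realType) (n : nat) (p : 'rV[R]_n -> \bar R)
    (x0 : 'rV[R]_n) : set 'rV[R]_n :=
  [set x | edom p x /\ (p x <= p x0)%E].

Definition Qfun (R : realType) (n : nat) (f g h1 h2 : 'rV[R]_n -> R)
    (C : set 'rV[R]_n) (x y z : 'rV[R]_n) (c : R) : \bar R :=
  if (y \in edom (conjugate g)) && (z \in edom (conjugate h2)) then
    (iota_set C x + (2 * c * f x)%:E
     + (c ^+ 2 * f x)%:E * (conjugate g y - (dot x y)%:E)
     + (h1 x)%:E + conjugate h2 z - (dot x z)%:E)%E
  else +oo%E.

(* Candidates for the next iterate after x, with step size a. *)
Definition ampda_trial (R : realType) (n : nat) (f g h1 : 'rV[R]_n -> R)
    (C : set 'rV[R]_n) (a : R) (x y z : 'rV[R]_n) : set 'rV[R]_n :=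
  let c := 1 / g x in
  prox (fun u => (a * c)%:E * restrict_to f C u)%E
       (x - a *: (grad h1 x - z - (c ^+ 2 * f x) *: y)).

Definition ampda_accept (R : realType) (n : nat)
    (f g h h1 h2 : 'rV[R]_n -> R) (C : set 'rV[R]_n) (sigma : R)
    (x y z xh : 'rV[R]_n) : Prop :=
  Omega g xh /\
  (Qfun f g h1 h2 C xh y z (1 / g xh) + (sigma / 2 * enorm (xh - x) ^+ 2)%:E
     <= objective f g h C x)%E.

(* One outer iteration, from x to x': the line search starts from the step
   size a, its trial points are xh 0, ..., xh m, and xh m is the first one to
   be accepted. *)
Definition ampda_step (R : realType) (n : nat)
    (f g h h1 h2 : 'rV[R]_n -> R) (C : set 'rV[R]_n)
    (alo ahi sigma gamma : R) (x x' : 'rV[R]_n) : Prop :=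
  exists (y z : 'rV[R]_n) (a : R) (m : nat) (xh : nat -> 'rV[R]_n),
    [/\ convex_subdiff g x y /\ convex_subdiff h2 x z,
        alo <= a <= ahi,
        forall i, (i <= m)%N ->
          ampda_trial f g h1 C (a * gamma ^+ i) x y z (xh i),
        forall i, (i < m)%N ->
          ~ ampda_accept f g h h1 h2 C sigma x y z (xh i) &
        ampda_accept f g h h1 h2 C sigma x y z (xh m) /\ x' = xh m].

Definition ampda_sequence (R : realType) (n : nat)
    (f g h h1 h2 : 'rV[R]_n -> R) (C : set 'rV[R]_n)
    (alo ahi sigma gamma : R) (x0 : 'rV[R]_n) (x : nat -> 'rV[R]_n) : Prop :=
  x 0%N = x0 /\
  forall k, ampda_step f g h h1 h2 C alo ahi sigma gamma (x k) (x k.+1).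

(* The last clause is membership of 0 in the Minkowski combination of the
   three subdifferentials. *)
Definition critical_point (R : realType) (n : nat)
    (f g h1 h2 : 'rV[R]_n -> R) (C : set 'rV[R]_n) (x : 'rV[R]_n) : Prop :=
  let c := 1 / g x in
  Omega g x /\
  exists u v w,
    [/\ frechet_subdiff (fun t => (c * f t)%:E + iota_set C t)%E x u,
        convex_subdiff g x v,
        convex_subdiff h2 x w &
        0 = u - (c ^+ 2 * f x) *: v + grad h1 x - w].

(* Main.v *)
(* A subgradient turns the Fenchel-Young inequality into an equality, so for
   the pair (y, z) chosen at x^k the value of Q at (x, y, z, c) is an
   explicit real number. It dominates F when c = 1 / g x, hence accepted
   steps decrease F by at least sigma / 2 |x^{k+1} - x^k|^2, and along a run
   with a cluster point xs the steps tend to 0.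

   Near xs the functions f / g^2, grad h1 are Lipschitz and the subgradients
   of g and h2 are bounded (a finite convex function is locally Lipschitz),
   so every trial point with a small enough step size is accepted: the
   recorded step sizes stay away from 0 near xs.

   Instead of extracting subsequences, take an ultrafilter on nat along which
   x^k -> xs; the bounded data y^k, z^k, alpha_k then converge along it. In
   the limit the optimality of x^{k+1} in the proximal problem says that xs
   minimizes c f + <v, . - xs> + |. - xs|^2 / (2 alpha) over C, which yields
   -v in the Frechet subdifferential. *)

Require Import Defs.
From HB Require Import structures.
From mathcomp Require Import all_boot all_order all_algebra.
From mathcomp Require Import all_classical all_reals all_analysis.
From mathcomp Require Import ring lra.

Set Implicit Arguments.
Unset Strict Implicit.
Unset Printing Implicit Defensive.

Import Order.TTheory GRing.Theory Num.Theory.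
Import numFieldNormedType.Exports.

Local Open Scope classical_set_scope.
Local Open Scope ring_scope.

(** * The Euclidean inner product and its comparison with the sup norm *)

Lemma dotC (R : realType) n (x y : 'rV[R]_n) : dot x y = dot y x.
Proof. by apply: eq_bigr => i _; rewrite mulrC. Qed.

Lemma dotDr (R : realType) n (x y z : 'rV[R]_n) :
  dot x (y + z) = dot x y + dot x z.
Proof. by rewrite -big_split; apply: eq_bigr => i _; rewrite mxE mulrDr. Qed.

Lemma dotZr (R : realType) n (a : R) (x y : 'rV[R]_n) :
  dot x (a *: y) = a * dot x y.
Proof. by rewrite mulr_sumr; apply: eq_bigr => i _; rewrite mxE mulrCA. Qed.

Lemma dotNr (R : realType) n (x y : 'rV[R]_n) : dot x (- y) = - dot x y.
Proof. by rewrite -scaleN1r dotZr mulN1r. Qed.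

Lemma dotDl (R : realType) n (x y z : 'rV[R]_n) :
  dot (y + z) x = dot y x + dot z x.
Proof. by rewrite dotC dotDr !(dotC x). Qed.

Lemma dotZl (R : realType) n (a : R) (x y : 'rV[R]_n) :
  dot (a *: y) x = a * dot y x.
Proof. by rewrite dotC dotZr (dotC x). Qed.

Lemma dotNl (R : realType) n (x y : 'rV[R]_n) : dot (- y) x = - dot y x.
Proof. by rewrite dotC dotNr (dotC x). Qed.

Lemma dotxx_ge0 (R : realType) n (x : 'rV[R]_n) : 0 <= dot x x.
Proof. by apply: sumr_ge0 => i _; rewrite -expr2 sqr_ge0. Qed.

Lemma enorm_sqr (R : realType) n (x : 'rV[R]_n) : enorm x ^+ 2 = dot x x.
Proof. by rewrite sqr_sqrtr ?dotxx_ge0. Qed.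

Lemma norm_rV_coord (R : realType) n (x : 'rV[R]_n) i : `|x ord0 i| <= `|x|.
Proof.
rewrite [leRHS]/Num.Def.normr /= mx_normrE; apply/bigmax_geP; right => /=.
by exists (ord0, i).
Qed.

Lemma norm_rV_le (R : realType) n (x : 'rV[R]_n) (r : R) :
  0 <= r -> (forall i, `|x ord0 i| <= r) -> `|x| <= r.
Proof.
move=> r0 xr; rewrite [leLHS]/Num.Def.normr /= mx_normrE (bigmax_le _ r0)//=.
by move=> -[i j] _ /=; rewrite ord1.
Qed.

Lemma norm_le_enorm (R : realType) n (x : 'rV[R]_n) : `|x| <= enorm x.
Proof.
apply: norm_rV_le => [|i]; first exact: sqrtr_ge0.
rewrite -sqrtr_sqr ler_sqrt ?dotxx_ge0// /dot (bigD1 i)//= -expr2 lerDl.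
by apply: sumr_ge0 => j _; rewrite -expr2 sqr_ge0.
Qed.

Lemma abs_dot_le (R : realType) n (x y : 'rV[R]_n) :
  `|dot x y| <= n%:R * (`|x| * `|y|).
Proof.
apply: (le_trans (ler_norm_sum _ _ _)).
have -> : n%:R * (`|x| * `|y|) = \sum_(i < n) `|x| * `|y|.
  by rewrite sumr_const card_ord mulr_natl.
by apply: ler_sum => i _; rewrite normrM ler_pM ?norm_rV_coord.
Qed.

(** * Finite convex functions: local Lipschitz bounds and subgradients *)

Lemma convex_onP (R : realType) n (p : 'rV[R]_n -> R) : convex_on_Rn p ->
  forall (t : R) x y, 0 <= t <= 1 ->
    p (t *: x + (1 - t) *: y) <= t * p x + (1 - t) * p y.
Proof.
move=> cp t x y t01.
have ht : Itv.spec (@Itv.num_sem R) (Itv.Real `[0%Z, 1%Z]) t.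
  by apply/andP; split; [rewrite realE; lra|rewrite /= in_itv /=].
by have := cp (Itv.mk ht) x y; rewrite !in_setT => /(_ isT isT).
Qed.

(** By induction on [k], the number of leading coordinates in which [d] may be nonzero. Moving the
    last of them to its extremes [r] and [- r] exhibits [x + d] as a convex combination of two
    points with one free coordinate fewer, around shifted centres. *)
Lemma convex_bounded_box (R : realType) n (p : 'rV[R]_n -> R) (r : R) k x :
  convex_on_Rn p -> 0 < r ->
  exists M, forall d : 'rV[R]_n, (forall i, `|d ord0 i| <= r) ->
    (forall i : 'I_n, (k <= i)%N -> d ord0 i = 0) -> p (x + d) <= M.
Proof.
move=> cp r0; elim: k x => [|k IH] x.
  exists (p x) => d _ d0; suff -> : d = 0 by rewrite addr0.
  by apply/rowP => i; rewrite d0// mxE.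
case: (ltnP k n) => [kn|nk]; last first.
  have [M HM] := IH x; exists M => d dr _; apply: HM => // i ki.
  by have := leq_trans nk ki; rewrite leqNgt ltn_ord.
pose i0 := Ordinal kn; pose e : 'rV[R]_n := delta_mx ord0 i0.
have [M1 H1] := IH (x + r *: e); have [M2 H2] := IH (x - r *: e).
exists (Num.max M1 M2) => d dr d0.
(* [t] solves [d ord0 i0 = t * r + (1 - t) * (- r)]. *)
pose d' := d - d ord0 i0 *: e; pose t := (d ord0 i0 + r) / (2 * r).
have d'r i : `|d' ord0 i| <= r.
  rewrite !mxE eqxx /=; case: eqP => [->|_].
    by rewrite mulr1 subrr normr0 ltW.
  by rewrite mulr0 subr0.
have d'0 (i : 'I_n) : (k <= i)%N -> d' ord0 i = 0.
  rewrite !mxE eqxx /=; case: (i =P i0) => [-> _|/eqP nei].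
    by rewrite mulr1 subrr.
  rewrite mulr0 subr0 leq_eqVlt => /orP[/eqP ki|]; last exact: d0.
  by case/negP: nei; apply/eqP/val_inj.
have t01 : 0 <= t <= 1.
  have /andP[h1 h2] : - r <= d ord0 i0 <= r by rewrite -ler_norml.
  by rewrite divr_ge0 ?ler_pdivrMr; lra.
have -> : x + d = t *: (x + r *: e + d') + (1 - t) *: (x - r *: e + d').
  apply/rowP => i; rewrite !mxE /t; field; lra.
apply: (le_trans (convex_onP cp _ _ t01)).
have le1 := H1 _ d'r d'0; have le2 := H2 _ d'r d'0.
have h1 : M1 <= Num.max M1 M2 by rewrite le_max lexx.
have h2 : M2 <= Num.max M1 M2 by rewrite le_max lexx orbT.
by move: (Num.max _ _) h1 h2 => M h1 h2; nra.
Qed.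

(** An upper bound on the ball of radius [2 * r] gives a lower bound by reflection in [x]. A slope
    inside the ball of radius [r] persists when the segment is prolonged by [r], still inside the
    larger ball, so the oscillation there limits it. *)
Lemma convex_lipschitz_ball (R : realType) n (p : 'rV[R]_n -> R) (r : R) x :
  convex_on_Rn p -> 0 < r ->
  exists2 K, 0 <= K & forall u w, `|u - x| <= r -> `|w - x| <= r ->
    `|p w - p u| <= K * `|w - u|.
Proof.
move=> cp r0.
have r20 : 0 < 2 * r by lra.
have [M0 HM0] := convex_bounded_box n x cp r20.
have HM u : `|u - x| <= 2 * r -> p u <= M0.
  move=> ur; rewrite -(subrKC x u) -[_ + _]/(x + (u - x)) ; apply: HM0 => i.
    by apply: le_trans ur; exact: norm_rV_coord.
  by rewrite leqNgt ltn_ord.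
have Hm u : `|u - x| <= 2 * r -> 2 * p x - M0 <= p u.
  move=> ur; have := HM (2 *: x - u).
  have -> : `|2 *: x - u - x| = `|u - x|.
    by rewrite -normrN; congr (`| _ |); apply/rowP => i; rewrite !mxE; ring.
  move=> /(_ ur) hM.
  have h01 : 0 <= (2^-1 : R) <= 1 by lra.
  have := convex_onP cp u (2 *: x - u) h01.
  have -> : 2^-1 *: u + (1 - 2^-1) *: (2 *: x - u) = x.
    by apply/rowP => i; rewrite !mxE; field.
  by move=> ?; lra.
have Mx := HM x; have mx := Hm x; rewrite subrr normr0 in Mx mx.
have {}Mx := Mx (ltW r20); have {}mx := mx (ltW r20).
(* The oscillation bound [M0 - (2 * p x - M0)] over the length [r] of the prolongation. *)
exists ((2 * M0 - 2 * p x) / r); first by rewrite divr_ge0; lra.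
have key u w : `|u - x| <= r -> `|w - x| <= r ->
    p w - p u <= (2 * M0 - 2 * p x) / r * `|w - u|.
  move=> ur wr.
  have [->|nwu] := eqVneq w u; first by rewrite !subrr normr0 mulr0.
  have d0 : 0 < `|w - u| by rewrite normr_gt0 subr_eq0.
  set d := `|w - u| in d0 *.
  (* [v] lies at distance [r] beyond [w] on the ray from [u]; [t] is its weight when [w] is written
     as a combination of [v] and [u]. *)
  pose v := w + (r / d) *: (w - u); pose t := d / (d + r).
  have dr0 : 0 < d + r by lra.
  have t01 : 0 <= t <= 1 by rewrite divr_ge0 ?ler_pdivrMr; lra.
  have vM : p v <= M0.
    apply: HM; rewrite /v addrAC (le_trans (ler_normD _ _))//.
    rewrite normrZ -/d normrM normfV (gtr0_norm d0) (gtr0_norm r0).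
    by rewrite divfK ?gt_eqF//; lra.
  have um : 2 * p x - M0 <= p u by apply: Hm; lra.
  have wE : t *: v + (1 - t) *: u = w.
    apply/rowP => i; rewrite !mxE /t; field.
    by rewrite !gt_eqF.
  have := convex_onP cp v u t01; rewrite wE => hw.
  have td : t <= d / r by rewrite ler_pM2l// lef_pV2 ?posrE//; lra.
  have : t * (p v - p u) <= d / r * (2 * M0 - 2 * p x).
    apply: (@le_trans _ _ (t * (2 * M0 - 2 * p x))).
      by apply: ler_wpM2l; lra.
    by apply: ler_wpM2r => //; lra.
  have -> : (2 * M0 - 2 * p x) / r * d = d / r * (2 * M0 - 2 * p x) by ring.
  by move=> ?; lra.
move=> u w ur wr; rewrite ler_norml; apply/andP; split; last exact: key.
by have := key w u wr ur; rewrite (distrC u w); lra.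
Qed.

Lemma convex_continuous (R : realType) n (p : 'rV[R]_n -> R) :
  convex_on_Rn p -> continuous p.
Proof.
move=> cp x; have [K K0 HK] := convex_lipschitz_ball x cp (@ltr01 R).
apply/(@cvgrPdist_le _ _ _ (nbhs x)) => e e0.
have K10 : 0 < K + 1 by lra.
apply/nbhs_ballP; exists (Num.min 1 (e / (K + 1))) => /=.
  by rewrite lt_min ltr01 divr_gt0.
move=> y; rewrite -ball_normE /= distrC lt_min => /andP[y1 ye].
have h : `|p y - p x| <= K * `|y - x|.
  by apply: HK; rewrite ?(ltW y1)// subrr normr0.
rewrite [leLHS]distrC (le_trans h)//; move: ye; rewrite ltr_pdivlMr//.
by have := normr_ge0 (y - x); nra.
Qed.

(** A subgradient is tested at distance [r] in its own direction, where the Lipschitz bound on the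
    ball of radius [2 * r] limits the growth of [p]. *)
Lemma subdiff_bounded (R : realType) n (p : 'rV[R]_n -> R) (r : R) x :
  convex_on_Rn p -> 0 < r ->
  exists2 K, 0 <= K & forall u y, `|u - x| <= r -> convex_subdiff p u y ->
    `|y| <= K.
Proof.
move=> cp r0.
have r20 : 0 < 2 * r by lra.
have [K K0 HK] := convex_lipschitz_ball x cp r20.
exists K => // u y ur yp.
have [->|y0] := eqVneq y 0; first by rewrite normr0.
have ny0 : 0 < `|y| by rewrite normr_gt0.
pose w := u + (r / `|y|) *: y.
have wu : `|w - u| = r.
  by rewrite /w addrAC subrr add0r normrZ normrM normfV normr_id
    (gtr0_norm r0) divfK ?gt_eqF.
have wx : `|w - x| <= 2 * r.
  by rewrite -(subrKA u) (le_trans (ler_normD _ _))// wu; lra.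
have ux : `|u - x| <= 2 * r by lra.
have := HK u w ux wx; rewrite wu => /(le_trans (ler_norm _)) h.
have := yp w; rewrite /w addrAC subrr add0r dotZr => h2.
have ye : `|y| * `|y| <= dot y y.
  by rewrite -enorm_sqr -!expr2 ler_sqr ?nnegrE ?norm_le_enorm ?sqrtr_ge0.
have : r / `|y| * (`|y| * `|y|) <= K * r.
  apply: (@le_trans _ _ (r / `|y| * dot y y)).
    by apply: ler_wpM2l => //; rewrite divr_ge0// ltW.
  by rewrite /w in h; lra.
rewrite mulrA divfK ?gt_eqF// mulrC ler_pM2r//.
Qed.

Lemma cvg_dot (R : realType) n T (F : set_system T) {FF : Filter F}
    (a b : T -> 'rV[R]_n) (la lb : 'rV[R]_n) :
  a @ F --> la -> b @ F --> lb ->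
  (fun t => dot (a t) (b t)) @ F --> dot la lb.
Proof.
move=> ala blb; rewrite /dot; apply: (cvg_big (op := +%R)) => [|i _].
  exact: add_continuous.
apply: cvgM.
  by exact: (cvg_comp _ _ ala (@coord_continuous _ _ _ ord0 i _)).
by exact: (cvg_comp _ _ blb (@coord_continuous _ _ _ ord0 i _)).
Qed.

Lemma subdiff_closed (R : realType) n (p : 'rV[R]_n -> R) T
    (F : set_system T) {FF : ProperFilter F} (x y : T -> 'rV[R]_n)
    (lx ly : 'rV[R]_n) :
  convex_on_Rn p -> x @ F --> lx -> y @ F --> ly ->
  (forall t, convex_subdiff p (x t) (y t)) -> convex_subdiff p lx ly.
Proof.
move=> cp xl yl xy z.
apply: (@cvgr_to_le _ F FF R (fun t => p (x t) + dot (y t) (z - x t))).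
- apply: cvgD; first by apply: continuous_cvg xl; exact: convex_continuous.
  by apply: cvg_dot => //; apply: cvgB => //; exact: cvg_cst.
- by apply: nearW => t; exact: xy.
Qed.

(** * Lipschitz gradients and the quadratic upper bound *)

Lemma lipschitz_onP (R : realType) (V W : normedModType R) (f : V -> W)
    (A : set V) : [lipschitz f x | x in A] ->
  exists2 K, 0 <= K & forall u w, A u -> A w -> `|f u - f w| <= K * `|u - w|.
Proof.
move=> lipf.
have [K [K0 HK]] :=
  filter_ex (filterI (nbhs_pinfty_ge (num_real (0 : R))) lipf).
by exists K => // u w Au Aw; exact: (HK (u, w)).
Qed.

Lemma derive_grad (R : realType) n (p : 'rV[R]_n -> R) (x v : 'rV[R]_n) :
  differentiable p x -> 'D_v p x = dot (grad p x) v.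
Proof.
move=> dp; rewrite deriveE// [in LHS](row_sum_delta v) linear_sum.
by apply: eq_bigr => i _; rewrite linearZ mxE deriveE// mulrC.
Qed.

Lemma is_derive_segment (R : realType) n (p : 'rV[R]_n -> R)
    (u d : 'rV[R]_n) (t : R) :
  differentiable p (u + t *: d) ->
  is_derive t 1 (fun s => p (u + s *: d)) (dot (grad p (u + t *: d)) d).
Proof.
move=> dp.
have E : (fun h : R => h^-1 *: (((fun s => p (u + s *: d)) \o shift t) (h *: 1)
      - p (u + t *: d))) =
    (fun h => h^-1 *: ((p \o shift (u + t *: d)) (h *: d) - p (u + t *: d))).
  apply/funext => h /=; congr (_ *: (p _ - _)).
  by rewrite -[h *: 1]/(h * 1) mulr1 scalerDl addrCA.
apply: DeriveDef.
  by rewrite /derivable E; exact: diff_derivable.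
by rewrite /derive E -derive_grad.
Qed.

(* The inequality is stated with the sup norm, so the constant absorbs [n]. *)
Lemma lipschitz_grad_upper_bound (R : realType) n (p : 'rV[R]_n -> R)
    (x : 'rV[R]_n) (r : R) :
  (forall y : 'rV[R]_n, ball x r y -> differentiable p y) ->
  [lipschitz (grad p y) | y in ball x r] ->
  exists2 L, 0 <= L & forall u w : 'rV[R]_n, ball x r u -> ball x r w ->
    p w <= p u + dot (grad p u) (w - u) + L * `|w - u| ^+ 2.
Proof.
move=> dp /lipschitz_onP[K K0 HK].
exists (n%:R * K); first by rewrite mulr_ge0.
move=> u w xu xw.
have seg t : 0 <= t <= 1 -> ball x r (u + t *: (w - u)).
  move=> /andP[t0 t1]; move: xu xw; rewrite -!ball_normE /= => xu xw.
  have -> : x - (u + t *: (w - u)) = (1 - t) *: (x - u) + t *: (x - w).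
    by apply/rowP => i; rewrite !mxE; ring.
  rewrite (le_lt_trans (ler_normD _ _))// !normrZ.
  have /ger0_norm -> : 0 <= 1 - t by lra.
  rewrite (ger0_norm t0) (@le_lt_trans _ _ (Num.max `|x - u| `|x - w|))//.
    have : `|x - u| <= Num.max `|x - u| `|x - w| by rewrite le_max lexx.
    have : `|x - w| <= Num.max `|x - u| `|x - w| by rewrite le_max lexx orbT.
    by move: (Num.max _ _) => m ? ?; nra.
  by rewrite gt_max xu xw.
pose phi t := p (u + t *: (w - u)).
have dphi (t : R) : t \in `[0, 1]%R ->
    is_derive t 1 phi (dot (grad p (u + t *: (w - u))) (w - u)).
  by rewrite in_itv /= => t01; apply: is_derive_segment; exact/dp/seg.
have cphi : {within `[0, 1], continuous phi}.
  by apply: derivable_within_continuous => t /dphi dt; exact: ex_derive.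
have dphi' (t : R) : t \in `]0, 1[%R ->
    is_derive t 1 phi (dot (grad p (u + t *: (w - u))) (w - u)).
  by rewrite in_itv /= => /andP[t0 t1]; apply: dphi; rewrite in_itv /= !ltW.
have [c c01] := MVT ltr01 dphi' cphi.
rewrite /phi scale1r scale0r addr0 subr0 mulr1 subrKC => E.
have {}c01 : 0 <= c <= 1.
  by move: c01; rewrite in_itv /= => /andP[? ?]; rewrite !ltW.
(* The mean value theorem supplies the gradient at a point of the segment; its difference from the
   gradient at [u] is controlled by [K]. *)
have -> : p w = p u + dot (grad p u) (w - u) +
    dot (grad p (u + c *: (w - u)) - grad p u) (w - u).
  by rewrite dotDl dotNl -E; ring.
rewrite lerD2l (le_trans (ler_norm _))// (le_trans (abs_dot_le _ _))//.
rewrite -mulrA ler_wpM2l// expr2 mulrA ler_wpM2r//.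
rewrite (le_trans (HK _ _ (seg _ c01) xu))// ler_wpM2l//.
rewrite addrAC subrr add0r normrZ; move: c01 => /andP[c0 c1].
by rewrite (ger0_norm c0) ler_piMl.
Qed.

(** * The acceptance test and the proximal step as inequalities between reals *)

Lemma conjugate_subdiff (R : realType) n (p : 'rV[R]_n -> R) (x y : 'rV[R]_n) :
  convex_subdiff p x y -> conjugate p y = (dot x y - p x)%:E.
Proof.
move=> yx; apply/eqP; rewrite eq_le; apply/andP; split.
  apply: ge_ereal_sup => _ [z _ <-]; rewrite lee_fin.
  by have := yx z; rewrite dotDr dotNr !(dotC y); lra.
by apply: ereal_sup_ubound; exists x.
Qed.

(** Equality in Fenchel-Young turns [conjugate g y - dot u y] into minus the affine minorant
    [g x + dot y (u - x)], and likewise for [h2]. *)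
Lemma Qfun_subdiff (R : realType) n (f g h1 h2 : 'rV[R]_n -> R) C
    (x y z u : 'rV[R]_n) (c : R) :
  convex_subdiff g x y -> convex_subdiff h2 x z ->
  Qfun f g h1 h2 C u y z c = if u \in C then
    (2 * c * f u - c ^+ 2 * f u * (g x + dot y (u - x)) + h1 u - h2 x
     - dot z (u - x))%:E else +oo%E.
Proof.
have domP p (w s : 'rV[R]_n) : convex_subdiff p w s -> s \in edom (conjugate p).
  by move=> ws; apply/mem_set; rewrite /edom /= (conjugate_subdiff ws) ltry.
move=> yx zx; rewrite /Qfun (domP _ _ _ yx) (domP _ _ _ zx) /=.
rewrite (conjugate_subdiff yx) (conjugate_subdiff zx).
rewrite /iota_set; case: ifP => // _.
rewrite -!(EFinD, EFinN, EFinM) add0r; congr EFin.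
by rewrite !dotDr !dotNr !(dotC y) !(dotC z); ring.
Qed.

Lemma ampda_acceptP (R : realType) n (f g h h1 h2 : 'rV[R]_n -> R) C
    (sigma : R) (x y z u : 'rV[R]_n) :
  Omega g x -> C x -> convex_subdiff g x y -> convex_subdiff h2 x z ->
  ampda_accept f g h h1 h2 C sigma x y z u <->
  [/\ Omega g u, C u & let c := 1 / g u in
    2 * c * f u - c ^+ 2 * f u * (g x + dot y (u - x)) + h1 u - h2 x
    - dot z (u - x) + sigma / 2 * dot (u - x) (u - x) <= f x / g x + h x].
Proof.
move=> gx Cx yx zx; rewrite /ampda_accept (Qfun_subdiff _ _ _ _ _ yx zx).
have -> : objective f g h C x = (f x / g x + h x)%:E.
  by rewrite /objective mem_set.
rewrite enorm_sqr; split => [[gu]|[gu Cu le]].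
  case: ifPn => [uC|_ //]; rewrite -EFinD lee_fin => le.
  by split => //; rewrite -inE.
by split=> //; rewrite mem_set// -EFinD lee_fin.
Qed.

Lemma ampda_trial_le (R : realType) n (f g h1 : 'rV[R]_n -> R) C
    (a : R) (x y z u : 'rV[R]_n) :
  0 < a -> 0 < g x -> C x -> ampda_trial f g h1 C a x y z u ->
  let v := grad h1 x - z - ((1 / g x) ^+ 2 * f x) *: y in
  C u /\ forall w, C w ->
    a * (1 / g x) * f u + 2^-1 * dot (u - x) (u - x) + a * dot v (u - x) <=
    a * (1 / g x) * f w + 2^-1 * dot (w - x) (w - x) + a * dot v (w - x).
Proof.
move=> a0 gx Cx tr v; rewrite /ampda_trial /prox /= in tr.
have ac : 0 < a * (1 / g x) by rewrite mulr_gt0// divr_gt0.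
have EC w : C w -> ((a * (1 / g x))%:E * restrict_to f C w)%E =
    (a * (1 / g x) * f w)%:E.
  by move=> Cw; rewrite /restrict_to /iota_set mem_set// adde0.
(* Outside [C] the proximal objective is infinite, whereas at [x] it is finite. *)
have Cu : C u.
  apply: contrapT => nCu; have := tr x; rewrite (EC _ Cx) -EFinD.
  rewrite /restrict_to /iota_set memNset// addey//.
  by rewrite gt0_muley ?lte_fin// addye.
split=> // w Cw; have := tr w; rewrite (EC _ Cw) (EC _ Cu) -!EFinD lee_fin.
rewrite !enorm_sqr.
(* The last term of the expanded square is the same for all candidates and cancels. *)
have E (v' t : 'rV[R]_n) : dot (x - a *: v' - t) (x - a *: v' - t) =
    dot (t - x) (t - x) + 2 * a * dot v' (t - x) + a ^+ 2 * dot v' v'.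
  rewrite !(dotDr, dotDl, dotNr, dotNl, dotZr, dotZl) (dotC x t) (dotC t v').
  by rewrite (dotC x v'); ring.
by rewrite !E -/v; lra.
Qed.

(** The affine minorants lie below [g] and [h2], and for [c = 1 / g u] the expression
    [2 * c * f u - c ^+ 2 * f u * g u] is [f u / g u]; so the tested value bounds the objective at
    [u] from above. *)
Lemma ampda_accept_descent (R : realType) n (f g h h1 h2 : 'rV[R]_n -> R) C
    (sigma : R) (x y z u : 'rV[R]_n) :
  (forall x, 0 <= f x) -> (forall x, 0 <= g x) ->
  (forall x, h x = h1 x - h2 x) ->
  Omega g x -> C x -> convex_subdiff g x y -> convex_subdiff h2 x z ->
  ampda_accept f g h h1 h2 C sigma x y z u ->
  [/\ Omega g u, C u & f u / g u + h u + sigma / 2 * dot (u - x) (u - x)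
    <= f x / g x + h x].
Proof.
move=> f0 g0 hE gx Cx yx zx /(ampda_acceptP f h h1 sigma _ gx Cx yx zx).
move=> [gu Cu le]; split=> //; apply: le_trans le => /=.
rewrite lerD2r hE; have := zx u; have := yx u.
have gu0 : 0 < g u by rewrite lt_def gu g0.
set dy := dot y _; set dz := dot z _ => le1 le2.
have : 1 / g u ^+ 2 * f u * (g x + dy) <= 1 / g u ^+ 2 * f u * g u.
  by apply: ler_wpM2l => //; rewrite mulr_ge0// divr_ge0// sqr_ge0.
have -> : 1 / g u ^+ 2 * f u * g u = f u / g u by field.
have -> : (1 / g u) ^+ 2 * f u * (g x + dy) = 1 / g u ^+ 2 * f u * (g x + dy).
  by field.
have -> : 2 * (1 / g u) * f u = 2 * (f u / g u) by field.
lra.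
Qed.

(** * Acceptance of small steps near a point of [Omega g] *)

Lemma lipschitzM (R : realType) (V : normedModType R) (A : set V)
    (f g : V -> R) (Kf Kg Mf Mg : R) :
  (forall u w, A u -> A w -> `|f u - f w| <= Kf * `|u - w|) ->
  (forall u w, A u -> A w -> `|g u - g w| <= Kg * `|u - w|) ->
  (forall u, A u -> `|f u| <= Mf) -> (forall u, A u -> `|g u| <= Mg) ->
  forall u w, A u -> A w ->
    `|f u * g u - f w * g w| <= (Mf * Kg + Mg * Kf) * `|u - w|.
Proof.
move=> lf lg bf bg u w Au Aw.
have -> : f u * g u - f w * g w = f u * (g u - g w) + g w * (f u - f w) by ring.
rewrite (le_trans (ler_normD _ _))// mulrDl !normrM -!mulrA.
by apply: lerD; apply: ler_pM; rewrite ?bf ?bg ?lf ?lg.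
Qed.

Lemma lipschitz_inv (R : realType) (V : normedModType R) (A : set V)
    (g : V -> R) (K m : R) :
  0 < m -> (forall u w, A u -> A w -> `|g u - g w| <= K * `|u - w|) ->
  (forall u, A u -> m <= g u) ->
  (forall u, A u -> `|(g u)^-1| <= m^-1) /\
  forall u w, A u -> A w -> `|(g u)^-1 - (g w)^-1| <= K / m ^+ 2 * `|u - w|.
Proof.
move=> m0 lg mg.
have g0 u : A u -> 0 < g u by move=> Au; rewrite (lt_le_trans m0) ?mg.
have ig u : A u -> `|(g u)^-1| <= m^-1.
  by move=> Au; rewrite normfV (gtr0_norm (g0 _ Au)) lef_pV2 ?posrE ?g0 ?mg.
split=> // u w Au Aw.
have -> : (g u)^-1 - (g w)^-1 = (g w - g u) * ((g u)^-1 * (g w)^-1).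
  by field; rewrite !gt_eqF ?g0.
rewrite !normrM mulrAC expr2 invfM ler_pM// ?mulr_ge0 ?normr_ge0//.
  by rewrite distrC lg.
by apply: ler_pM; rewrite ?normr_ge0 ?ig.
Qed.

(* The displacement of a proximal step vanishes with the step size. *)
Lemma step_small (R : realType) (N a r M V : R) :
  0 <= N -> 0 < a -> 0 < r -> 0 <= M -> 0 <= V ->
  a <= r / (4 * (V + 1)) -> a <= r ^+ 2 / (4 * (M + 1)) ->
  2^-1 * N ^+ 2 <= a * (M + V * N) -> N <= r.
Proof.
move=> N0 a0 r0 M0 V0.
rewrite !ler_pdivlMr; [|lra|lra] => aV aM le; rewrite leNgt; apply/negP => rN.
(* If [r < N], the bounds on [a] give [a * M <= r ^+ 2 / 4] and [a * V * N <= r * N / 4], whose sum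
   is below [2^-1 * N ^+ 2]. *)
have : r * N < N * N by rewrite ltr_pM2r// (lt_trans r0).
have : r * r < r * N by rewrite ltr_pM2l.
have : 0 <= (r - a * (4 * (V + 1))) * N by rewrite mulr_ge0// subr_ge0.
have : 0 < a * N by rewrite mulr_gt0// (lt_trans r0).
rewrite !expr2 in aM le *; lra.
Qed.

(** Here [D] stands for the squared step length and [Gd], [Yd], [Zd] for the products of the step
    with the gradient and the two subgradients. Divided by [a], the proximal inequality yields
    [2^-1 / a * D], which pays for the error of [h1], the descent term and the change of
    [f / g ^+ 2]. *)
Lemma trial_accepted_real (R : realType) (a sigma L D S fu fx gu gx Gd Yd Zd
    h1u h1x h2x : R) :
  0 < a -> 0 < gu -> 0 < gx -> 0 <= fu -> 0 <= D ->
  h1u <= h1x + Gd + L * D ->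
  a * (1 / gx) * fu + 2^-1 * D +
    a * (Gd - Zd - (1 / gx) ^+ 2 * fx * Yd) <= a * (1 / gx) * fx ->
  ((1 / gx) ^+ 2 * fx - (1 / gu) ^+ 2 * fu) * Yd <= S * D ->
  a * (L + sigma / 2 + S) <= 2^-1 ->
  2 * (1 / gu) * fu - (1 / gu) ^+ 2 * fu * (gx + Yd) + h1u - h2x - Zd
    + sigma / 2 * D <= fx / gx + (h1x - h2x).
Proof.
move=> a0 gu0 gx0 fu0 D0 hL tr hS ha.
have {tr} : (1 / gx) * fu + (2^-1 / a) * D +
    (Gd - Zd - (1 / gx) ^+ 2 * fx * Yd) <= (1 / gx) * fx.
  rewrite -(ler_pM2l a0) [leRHS]mulrA; apply: le_trans tr.
  rewrite le_eqVlt; apply/orP; left; apply/eqP; field.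
  by rewrite !gt_eqF.
have : (L + sigma / 2 + S) * D <= 2^-1 / a * D.
  by apply: ler_wpM2r => //; rewrite ler_pdivlMr// mulrC.
(* [1 / gx - 2 / gu + gx / gu ^+ 2] is [gx] times a square; this absorbs the
   change of the coefficient of [fu] from [1 / gx] to [1 / gu]. *)
have : 0 <= fu * (gx * (1 / gu - 1 / gx) ^+ 2).
  by rewrite mulr_ge0// mulr_ge0 ?sqr_ge0// ltW.
have -> : gx * (1 / gu - 1 / gx) ^+ 2 =
    (1 / gu) ^+ 2 * gx - 2 * (1 / gu) + 1 / gx.
  by field; rewrite !gt_eqF.
have -> : fx / gx = 1 / gx * fx by rewrite mul1r mulrC.
move: (1 / gu) (1 / gx) (2^-1 / a) hS => cu cx ia; lra.
Qed.

Lemma dotx0 (R : realType) n (x : 'rV[R]_n) : dot x 0 = 0.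
Proof. by rewrite -[0 in LHS](scale0r (0 : 'rV[R]_n)) dotZr mul0r. Qed.

(** All constants are uniform on one ball around [xs] where [g] is bounded away from 0; a short step
    keeps the trial point in it, so the estimates apply at both ends of the step. *)
Lemma line_search_near (R : realType) n (f g h h1 h2 : 'rV[R]_n -> R)
    (C : set 'rV[R]_n) (sigma : R) (xs : 'rV[R]_n) :
  (forall x, 0 <= f x) -> (forall x, 0 <= g x) ->
  locally_lipschitz_on (Omega g) f -> convex_on_Rn g ->
  (forall x, h x = h1 x - h2 x) ->
  locally_lipschitz_differentiable_on (Omega g) h1 -> convex_on_Rn h2 ->
  0 < sigma -> Omega g xs ->
  exists r, exists2 amin, 0 < amin & 0 < r /\
    forall a x y z u, `|x - xs| <= r -> C x -> 0 < a -> a <= amin ->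
      convex_subdiff g x y -> convex_subdiff h2 x z ->
      ampda_trial f g h1 C a x y z u ->
      ampda_accept f g h h1 h2 C sigma x y z u.
Proof.
move=> f0 g0 flip gc hE h1s h2c s0 gxs.
have gxs0 : 0 < g xs by rewrite lt_def gxs g0.
have [Kg Kg0 Hg] := convex_lipschitz_ball xs gc (@ltr01 R).
have [r2 r20 /lipschitz_onP[Kf Kf0 Hf]] := flip _ gxs.
have [r3 r30 [dh1 _ lh1]] := h1s _ gxs.
have [L L0 HL] := lipschitz_grad_upper_bound dh1 lh1.
have [K K0 HK] := lipschitz_onP lh1.
pose m := g xs / 2; have m0 : 0 < m by rewrite divr_gt0.
(* The bounds on [r] keep [g] above [m] and place the ball inside the regions of the Lipschitz
   estimates of [g], [f] and [grad h1]. *)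
pose r := Num.min (Num.min 1 (m / (Kg + 1))) (Num.min (r2 / 2) (r3 / 2)).
have Kg10 : 0 < Kg + 1 by lra.
have r0 : 0 < r by rewrite !lt_min ltr01 !divr_gt0.
have /andP[/andP[r1 rm] /andP[rr2 rr3]] :
    ((r <= 1) && (r <= m / (Kg + 1))) && ((r <= r2 / 2) && (r <= r3 / 2)).
  by rewrite -!le_min.
pose A := [set u : 'rV[R]_n | `|u - xs| <= r].
have Axs : A xs by rewrite /A /= subrr normr0 ltW.
have lg u w : A u -> A w -> `|g u - g w| <= Kg * `|u - w|.
  by move=> Au Aw; apply: Hg; apply: le_trans r1.
have mg u : A u -> m <= g u.
  move=> Au; have := le_trans (ler_norm _) (lg _ _ Axs Au).
  have : Kg * `|xs - u| <= Kg * r by rewrite ler_wpM2l// distrC.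
  by move: rm; rewrite ler_pdivlMr// /m; lra.
have gpos u : A u -> 0 < g u by move=> /mg; exact: lt_le_trans.
have b2 u : A u -> (ball xs r2 `&` Omega g) u.
  move=> Au; split; last by rewrite /Omega /= gt_eqF// gpos.
  by rewrite -ball_normE /= distrC (le_lt_trans Au)//; lra.
have b3 u : A u -> ball xs r3 u.
  by move=> Au; rewrite -ball_normE /= distrC (le_lt_trans Au)//; lra.
have lf u w : A u -> A w -> `|f u - f w| <= Kf * `|u - w|.
  by move=> /b2 Au /b2 Aw; apply: Hf.
pose Mf := `|f xs| + Kf * r.
have bf u : A u -> `|f u| <= Mf.
  move=> Au; rewrite -(subrKC (f xs) (f u)) (le_trans (ler_normD _ _))//.
  by rewrite lerD2l (le_trans (lf _ _ Au Axs))// ler_wpM2l.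
have [bi li] := lipschitz_inv m0 lg mg.
(* [Mphi] and [Kphi] are a bound and a Lipschitz constant of [f / g ^+ 2] on [A]; [M] bounds
   [f / g]. *)
pose Mphi := m^-1 * m^-1 * Mf; pose M := m^-1 * Mf.
pose Kphi := m^-1 * m^-1 * Kf
  + Mf * (m^-1 * (Kg / m ^+ 2) + m^-1 * (Kg / m ^+ 2)).
have bi2 u : A u -> `|(g u)^-1 * (g u)^-1| <= m^-1 * m^-1.
  by move=> Au; rewrite normrM ler_pM ?bi.
have bphi u : A u -> `|(g u)^-1 * (g u)^-1 * f u| <= Mphi.
  by move=> Au; rewrite normrM ler_pM ?bi2 ?bf.
have bcf u : A u -> `|(g u)^-1 * f u| <= M.
  by move=> Au; rewrite normrM ler_pM ?bi ?bf.
have lphi u w : A u -> A w ->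
    `|(g u)^-1 * (g u)^-1 * f u - (g w)^-1 * (g w)^-1 * f w| <= Kphi * `|u - w|.
  by apply: (fun H => lipschitzM H lf bi2 bf); exact: (lipschitzM li li bi bi).
have Mf0 : 0 <= Mf by rewrite (le_trans _ (bf _ Axs)).
have mi0 : 0 <= m^-1 by rewrite invr_ge0 ltW.
have [Y Y0 HY] := subdiff_bounded xs gc r0.
have [Z Z0 HZ] := subdiff_bounded xs h2c r0.
pose G := `|grad h1 xs| + K * r.
have bG u : A u -> `|grad h1 u| <= G.
  move=> Au; rewrite -[grad h1 u](subrKC (grad h1 xs)).
  rewrite (le_trans (ler_normD _ _))// lerD2l.
  by rewrite (le_trans (HK _ _ (b3 _ Au) (b3 _ Axs)))// ler_wpM2l.
pose V := n%:R * (G + Z + Mphi * Y).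
pose S := Kphi * (n%:R * Y).
have Mphi0 : 0 <= Mphi by rewrite (le_trans _ (bphi _ Axs)).
have Kphi0 : 0 <= Kphi.
  rewrite addr_ge0 ?mulr_ge0// addr_ge0// !mulr_ge0//.
    by rewrite invr_ge0 exprn_ge0// ltW.
  by rewrite invr_ge0 exprn_ge0// ltW.
have M0 : 0 <= M by rewrite (le_trans _ (bcf _ Axs)).
have G0 : 0 <= G by rewrite (le_trans _ (bG _ Axs)).
have V0 : 0 <= V.
  apply: mulr_ge0 => //; apply: addr_ge0; first exact: addr_ge0.
  exact: mulr_ge0.
have S0 : 0 <= S by apply: mulr_ge0 => //; exact: mulr_ge0.
(* Starting within [rho] of [xs] and moving by at most [rho] stays in [A]. The first bound in [amin]
   serves the acceptance inequality, the other two the length of the step. *)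
pose rho := r / 2; have rho0 : 0 < rho by rewrite divr_gt0.
pose amin := Num.min (2^-1 / (L + sigma / 2 + S))
  (Num.min (rho / (4 * (V + 1))) (rho ^+ 2 / (4 * (M + 1)))).
have LS0 : 0 < L + sigma / 2 + S by lra.
exists rho, amin.
  by rewrite !lt_min !divr_gt0 ?exprn_gt0//; lra.
split=> // a x y z u xrho Cx a0.
rewrite !le_min => /andP[a1 /andP[a2 a3]] yx zx.
have Ax : A x by rewrite /A /= (le_trans xrho)// /rho; lra.
(* The competitor is [x] itself, where the quadratic and linear terms vanish. *)
move=> /(ampda_trial_le a0 (gpos _ Ax) Cx)[Cu /(_ x Cx)].
set v := grad h1 x - _ - _; set d := u - x.
rewrite subrr !dotx0 !mulr0 !addr0 => tr.
have dN : `|d| ^+ 2 <= dot d d.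
  by rewrite -enorm_sqr ler_sqr ?nnegrE ?sqrtr_ge0// norm_le_enorm.
have c2E w : (1 / g w) ^+ 2 * f w = (g w)^-1 * (g w)^-1 * f w.
  by rewrite mul1r expr2.
have yY := HY _ _ Ax yx; have zZ := HZ _ _ Ax zx.
have vV : `|dot v d| <= V * `|d|.
  rewrite /v (le_trans (abs_dot_le _ _))// /V -mulrA ler_wpM2l// ler_wpM2r//.
  rewrite (le_trans (ler_normB _ _))// lerD//; last first.
    by rewrite c2E normrZ ler_pM ?bphi.
  by rewrite (le_trans (ler_normB _ _))// lerD// bG.
have ud : `|d| <= rho.
  apply: (step_small _ a0 rho0 M0 V0 a2 a3) => //.
  have : 0 <= a * (1 / g x) * f u.
    by rewrite mulr_ge0// mulr_ge0 ?divr_ge0// ltW.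
  have : a * (1 / g x) * f x <= a * M.
    rewrite -mulrA ler_wpM2l ?(ltW a0)// mul1r.
    by rewrite (le_trans (ler_norm _))// bcf.
  have : a * - dot v d <= a * (V * `|d|).
    by rewrite ler_wpM2l ?(ltW a0)// (le_trans _ vV)// -normrN ler_norm.
  by rewrite mulrDr; lra.
have Au : A u.
  have -> : u = d + x by rewrite /d subrK.
  rewrite /A /= -addrA (le_trans (ler_normD _ _))//.
  by move: ud xrho; rewrite /rho; lra.
have Om w : A w -> Omega g w by move=> Aw; rewrite /Omega /= gt_eqF// gpos.
apply/(ampda_acceptP f h h1 sigma u (Om _ Ax) Cx yx zx).
split => //; first exact: Om.
rewrite /= hE.
apply: (@trial_accepted_real _ a _ L _ S _ _ _ _ (dot (grad h1 x) d)) => //.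
- exact: gpos.
- exact: gpos.
- exact: dotxx_ge0.
- rewrite (le_trans (HL _ _ (b3 _ Ax) (b3 _ Au)))// lerD2l ler_wpM2l//.
- by move: tr; rewrite /v !(dotDl, dotNl, dotZl).
- rewrite !c2E (le_trans (ler_norm _))// normrM /S.
  apply: (@le_trans _ _ (Kphi * (n%:R * Y) * `|d| ^+ 2)); last first.
    by rewrite ler_wpM2l.
  have -> : Kphi * (n%:R * Y) * `|d| ^+ 2 = Kphi * `|d| * (n%:R * (Y * `|d|)).
    by ring.
  apply: ler_pM => //; first by rewrite (le_trans (lphi _ _ Ax Au))// distrC.
  by rewrite (le_trans (abs_dot_le _ _))// ler_wpM2l// ler_wpM2r.
- by move: a1; rewrite ler_pdivlMr.
Qed.

(** * Ultrafilters, compactness and Fréchet subgradients *)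

Lemma enorm_le_norm (R : realType) n (x : 'rV[R]_n) : enorm x <= n%:R * `|x|.
Proof.
have nx0 : 0 <= n%:R * `|x| by rewrite mulr_ge0.
rewrite -[leRHS]ger0_norm// -sqrtr_sqr ler_sqrt ?sqr_ge0//.
rewrite (le_trans (ler_norm _))// (le_trans (abs_dot_le _ _))//.
rewrite expr2 mulrACA -[leLHS]mul1r mulrA ler_wpM2r ?mulr_ge0//.
rewrite mul1r -natrM ler_nat; by case: (n) => // k; rewrite leq_pmulr.
Qed.

(** Tails of [nat] meet the preimages of all neighbourhoods of a cluster point, so together they
    generate a proper filter, which an ultrafilter refines. *)
Lemma cluster_ultra (T : topologicalType) (x : nat -> T) (xs : T) :
  cluster (x @ \oo) xs ->
  exists U, [/\ UltraFilter U, \oo `<=` U & x @ U --> xs].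
Proof.
move=> xxs.
pose D := [set P : set nat * set T | \oo P.1 /\ nbhs xs P.2].
pose F := filter_from D (fun P => P.1 `&` x @^-1` P.2).
have FF : ProperFilter F.
  apply: filter_from_proper; last first.
    move=> [A B] [/= oA sB]; have [] := xxs (x @` A) B _ sB.
      by apply: filterS oA => k Ak; exists k.
    by move=> _ [[k Ak <-] Bk]; exists k.
  apply: filter_from_filter.
    by exists (setT, setT); split; exact: filterT.
  move=> [A1 B1] [A2 B2] [/= oA1 sB1] [/= oA2 sB2].
  exists (A1 `&` A2, B1 `&` B2); first by split; exact: filterI.
  by move=> k /= [[? ?] [? ?]].
have [U [UU FU]] := ultraFilterLemma FF.
exists U; split => // A hA; apply: FU.
  by exists (A, setT); [split => //; exact: filterT|move=> k []].
by exists (setT, A); [split => //; exact: filterT|move=> k []].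
Qed.

(** Compactness gives a cluster point; as an ultrafilter contains each set or its complement, a
    cluster point is a limit. *)
Lemma ultra_compact_cvg (S : Type) (T : topologicalType) (U : set_system S)
    (y : S -> T) (A : set T) :
  UltraFilter U -> compact A -> U (y @^-1` A) -> exists2 l, A l & y @ U --> l.
Proof.
move=> UU cA UA; have [l [Al cl]] := cA (y @ U) _ UA.
exists l => // B lB; have [//|nB] := in_ultra_setVsetC (y @^-1` B) UU.
by have [t []] := cl (~` B) B nB lB.
Qed.

(** The difference quotient is at least [- K * enorm (w - xs)] on [C] and infinite off [C]. *)
Lemma frechet_subdiff_quadratic (R : realType) n (p : 'rV[R]_n -> R)
    (C : set 'rV[R]_n) (K : R) (xs u : 'rV[R]_n) : C xs -> 0 <= K ->
  (forall w, C w ->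
    - (K * dot (w - xs) (w - xs)) <= p w - p xs - dot u (w - xs)) ->
  frechet_subdiff (fun t => (p t)%:E + iota_set C t)%E xs u.
Proof.
move=> Cxs K0 Hp; rewrite /frechet_subdiff /= /edom /=.
have iC w : C w -> iota_set C w = 0%E by move=> Cw; rewrite /iota_set mem_set.
rewrite (iC _ Cxs) adde0; split; first exact: ltry.
rewrite limf_einfE; apply/lee_subgt0Pr => e e0; rewrite sub0e.
set q := (X in X @` _).
(* The lower limit is a supremum of infima; on [V] the quotient is at least [- e]. *)
pose V := [set w | w != xs /\ K * enorm (w - xs) <= e].
apply: (@le_trans _ _ (q V)); last first.
  apply: ereal_sup_ubound; exists V => //.
  have Kn0 : 0 < K * n%:R + 1 by rewrite ltr_wpDl// mulr_ge0.
  apply/nbhs_ballP; exists (e / (K * n%:R + 1)) => /=; first exact: divr_gt0.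
  move=> w; rewrite -ball_normE /= ltr_pdivlMr// distrC => we wxs; split => //.
  have := ler_wpM2l K0 (enorm_le_norm (w - xs)); rewrite mulrA.
  by have := normr_ge0 (w - xs); lra.
rewrite /q; apply: le_ereal_inf_tmp => _ [w [wxs wV] <-].
have ew0 : 0 < enorm (w - xs).
  by rewrite (lt_le_trans _ (norm_le_enorm _))// normr_gt0 subr_eq0.
have [Cw|nCw] := pselect (C w); last first.
  rewrite /iota_set memNset// addey// !addye// gt0_mulye ?leey//.
  by rewrite lte_fin invr_gt0.
rewrite (iC _ Cw) adde0 -!EFinB -EFinM lee_fin ler_pdivlMr//.
apply: le_trans (Hp _ Cw); rewrite -enorm_sqr expr2 mulNr lerN2 mulrA.
by rewrite ler_wpM2r// ltW.
Qed.

Lemma compact_norm_le (R : realType) n (K : R) :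
  compact [set t : 'rV[R]_n | `|t| <= K].
Proof.
apply: bounded_closed_compact.
  exists K; rewrite num_real; split => // M KM t /= /le_trans; apply.
  exact: ltW.
have -> : [set t : 'rV[R]_n | `|t| <= K] = Num.norm @^-1` [set s | s <= K].
  by [].
apply: (closed_comp _ (@closed_le _ K)) => t _; exact: norm_continuous.
Qed.

Lemma lipschitz_continuous_at (R : realType) (V W : normedModType R)
    (f : V -> W) (A : set V) (x : V) :
  nbhs x A -> [lipschitz f y | y in A] -> {for x, continuous f}.
Proof.
move=> xA /lipschitz_onP[K K0 HK]; apply/(@cvgrPdist_le _ _ _ (nbhs x)) => e e0.
have K10 : 0 < K + 1 by lra.
have xB := nbhsx_ballx x _ (divr_gt0 e0 K10).
apply: (@filterS _ (nbhs x) _ _ _ _ (filterI xA xB)) => y [Ay].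
rewrite -ball_normE /= ltr_pdivlMr// => xy.
rewrite (le_trans (HK _ _ (nbhs_singleton xA) Ay))//.
by have := normr_ge0 (x - y); lra.
Qed.

(** * Descent along a run *)

(** The last clause is what bounds the step size from below: either the first trial was accepted, or
    the preceding trial, of size [a / gamma], was rejected. The data form one triple so that
    [choice] can select them for all iterations. *)
Lemma ampda_step_spec (R : realType) n (f g h h1 h2 : 'rV[R]_n -> R)
    (C : set 'rV[R]_n) (alo ahi sigma gamma : R) (x x' : 'rV[R]_n) :
  0 < alo -> 0 < gamma -> gamma < 1 ->
  ampda_step f g h h1 h2 C alo ahi sigma gamma x x' ->
  exists p : 'rV[R]_n * 'rV[R]_n * R, let: (y, z, a) := p in
    [/\ convex_subdiff g x y, convex_subdiff h2 x z, 0 < a <= ahi,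
      ampda_trial f g h1 C a x y z x' /\
        ampda_accept f g h h1 h2 C sigma x y z x' &
      alo <= a \/ exists2 u, ampda_trial f g h1 C (a / gamma) x y z u &
        ~ ampda_accept f g h h1 h2 C sigma x y z u].
Proof.
move=> alo0 g0 g1 [y [z [a [m [xh [[yx zx] /andP[aa ah] tr rej [acc ->]]]]]]].
have a0 : 0 < a by exact: lt_le_trans alo0 aa.
exists (y, z, a * gamma ^+ m); split => //.
- rewrite mulr_gt0 ?exprn_gt0//= (le_trans _ ah)// ler_piMr ?(ltW a0)//.
  by rewrite exprn_ile1 ?ltW.
- by split => //; exact: tr.
- case: m tr rej acc => [|m] tr rej acc; first by left; rewrite mulr1.
  right; exists (xh m); last exact: rej.
  by rewrite exprSr mulrA mulfK ?gt_eqF//; exact: tr.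
Qed.

Lemma ampda_descent (R : realType) n (f g h h1 h2 : 'rV[R]_n -> R)
    (C : set 'rV[R]_n) (alo ahi sigma gamma : R) (x0 : 'rV[R]_n)
    (x : nat -> 'rV[R]_n) :
  (forall x, 0 <= f x) -> (forall x, 0 <= g x) ->
  (forall x, h x = h1 x - h2 x) -> 0 < alo -> 0 < gamma -> gamma < 1 ->
  edom (objective f g h C) x0 ->
  ampda_sequence f g h h1 h2 C alo ahi sigma gamma x0 x ->
  forall k, [/\ Omega g (x k), C (x k) &
    f (x k.+1) / g (x k.+1) + h (x k.+1)
      + sigma / 2 * dot (x k.+1 - x k) (x k.+1 - x k)
    <= f (x k) / g (x k) + h (x k)].
Proof.
move=> f0 g0 hE alo0 ga0 ga1 x0d [x0E run].
have step k : Omega g (x k) -> C (x k) -> [/\ Omega g (x k.+1), C (x k.+1) &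
    f (x k.+1) / g (x k.+1) + h (x k.+1)
      + sigma / 2 * dot (x k.+1 - x k) (x k.+1 - x k)
    <= f (x k) / g (x k) + h (x k)].
  move=> gk Ck.
  have [[[y z] a] [yx zx _ [_ acc] _]] := ampda_step_spec alo0 ga0 ga1 (run k).
  exact: ampda_accept_descent acc.
have dom k : Omega g (x k) /\ C (x k).
  elim: k => [|k [gk Ck]]; last by have [] := step k gk Ck.
  move: x0d; rewrite x0E /edom /= /objective; case: ifPn => [|_].
    by rewrite inE => -[].
  by rewrite ltxx.
by move=> k; have [gk Ck] := dom k; have [_ _ ?] := step k gk Ck.
Qed.

(* A subsequence bounded below suffices, since the sequence of values is
   monotone; lower semicontinuity of [p] at the cluster point provides it. *)
Lemma cvg_values_of_descent (R : realType) n (p : 'rV[R]_n -> R) (v : nat -> R)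
    (x : nat -> 'rV[R]_n) (xs : 'rV[R]_n) :
  lower_semicontinuous (fun x => (p x)%:E) -> cluster (x @ \oo) xs ->
  (forall k, v k.+1 <= v k) -> (forall k, p (x k) <= v k) -> cvgn v.
Proof.
move=> plsc xxs vdec pv.
have vd : nonincreasing_seq v by exact/nonincreasing_seqP.
have [|V sV HV] := plsc xs (p xs - 1); first by rewrite lte_fin; lra.
apply: nonincreasing_is_cvgn => //; exists (p xs - 1) => _ [k _ <-].
have [|_ [[j /= kj <-] Vj]] := xxs (x @` [set j | (k <= j)%N]) V _ sV.
  by exists k => // j /= kj; exists j.
have := HV _ Vj; rewrite lte_fin => /ltW /le_trans; apply.
exact: le_trans (pv j) (vd _ _ kj).
Qed.

(** Consecutive differences of a convergent [v] vanish, and they dominate [s] times the squared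
    steps. *)
Lemma step_cvg0 (R : realType) n (s : R) (v : nat -> R)
    (x : nat -> 'rV[R]_n) :
  0 < s -> cvgn v ->
  (forall k, v k.+1 + s * dot (x k.+1 - x k) (x k.+1 - x k) <= v k) ->
  (fun k => x k.+1 - x k) @ \oo --> (0 : 'rV[R]_n).
Proof.
move=> s0 cv dec.
have dv : (fun k => v k - v k.+1) @ \oo --> 0.
  rewrite -(subrr (lim (v @ \oo))); apply: cvgB => //.
  by rewrite (cvg_shiftS v).
apply/cvgr0Pnorm_le => e e0.
have se0 : 0 < s * e ^+ 2 by rewrite mulr_gt0// exprn_gt0.
move/cvgr0Pnorm_le : dv => /(_ _ se0); apply: filterS => k /=.
move=> /(le_trans (ler_norm _)) le.
rewrite -ler_sqr ?nnegrE ?(ltW e0)//; have := dec k.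
have le2 : `|x k.+1 - x k| ^+ 2 <= dot (x k.+1 - x k) (x k.+1 - x k).
  by rewrite -enorm_sqr ler_sqr ?nnegrE ?sqrtr_ge0// norm_le_enorm.
by move=> deck; rewrite (le_trans le2)// -(ler_pM2l s0); lra.
Qed.

(** * Passage to the limit along a filter *)

Lemma critical_point_of_limit (R : realType) n (f g h1 h2 : 'rV[R]_n -> R)
    (C : set 'rV[R]_n) (T : Type) (F : set_system T) {FF : ProperFilter F}
    (x x' y z : T -> 'rV[R]_n) (a : T -> R) (xs ys zs : 'rV[R]_n) (al : R) :
  convex_on_Rn g -> convex_on_Rn h2 -> (forall x, 0 <= g x) ->
  {for xs, continuous f} -> {for xs, continuous (grad h1)} ->
  Omega g xs -> C xs -> 0 < al ->
  x @ F --> xs -> x' @ F --> xs -> y @ F --> ys -> z @ F --> zs ->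
  a @ F --> al ->
  (forall t, [/\ Omega g (x t), C (x t), convex_subdiff g (x t) (y t),
    convex_subdiff h2 (x t) (z t) &
    0 < a t /\ ampda_trial f g h1 C (a t) (x t) (y t) (z t) (x' t)]) ->
  critical_point f g h1 h2 C xs.
Proof.
move=> gc h2c g0 fc h1c gxs Cxs al0 xl x'l yl zl aL H.
pose c := 1 / g xs.
pose vs := grad h1 xs - zs - (c ^+ 2 * f xs) *: ys.
have gl : (fun t => g (x t)) @ F --> g xs.
  by apply: continuous_cvg xl; exact: convex_continuous.
have cl : (fun t => 1 / g (x t)) @ F --> c.
  by apply: cvgM; [exact: cvg_cst|exact: cvgV].
have fl : (fun t => f (x t)) @ F --> f xs by apply: continuous_cvg xl.
have f'l : (fun t => f (x' t)) @ F --> f xs by apply: continuous_cvg x'l.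
have vl : (fun t => grad h1 (x t) - z t -
    ((1 / g (x t)) ^+ 2 * f (x t)) *: y t) @ F --> vs.
  apply: cvgB.
    by apply: cvgB => //; apply: continuous_cvg xl.
  apply: cvgZ => //; apply: cvgM => //.
  by rewrite expr2; under eq_fun do rewrite expr2; exact: cvgM.
have dl w : (fun t => w - x t) @ F --> w - xs.
  by apply: cvgB => //; exact: cvg_cst.
have d'l : (fun t => x' t - x t) @ F --> (0 : 'rV[R]_n).
  by rewrite -(subrr xs); exact: cvgB.
(* The limit of the optimality of [x' t] against a fixed competitor [w]; the terms in [x' t - x t]
   vanish. *)
have key w : C w -> al * c * f xs <=
    al * c * f w + 2^-1 * dot (w - xs) (w - xs) + al * dot vs (w - xs).
  move=> Cw; rewrite -subr_ge0.
  pose v t := grad h1 (x t) - z t - ((1 / g (x t)) ^+ 2 * f (x t)) *: y t.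
  pose e t := a t * (1 / g (x t)) * f w + 2^-1 * dot (w - x t) (w - x t)
      + a t * dot (v t) (w - x t) -
    (a t * (1 / g (x t)) * f (x' t) + 2^-1 * dot (x' t - x t) (x' t - x t)
      + a t * dot (v t) (x' t - x t)).
  have el : e @ F --> al * c * f w + 2^-1 * dot (w - xs) (w - xs)
      + al * dot vs (w - xs) -
      (al * c * f xs + 2^-1 * dot (0 : 'rV[R]_n) 0 + al * dot vs 0).
    have acl : (fun t => a t * (1 / g (x t))) @ F --> al * c by exact: cvgM.
    have cst r : (fun _ : T => r : R) @ F --> r by exact: cvg_cst.
    apply: cvgB; apply: cvgD.
    - exact: (cvgD (cvgM acl (cst _)) (cvgM (cst _) (cvg_dot (dl w) (dl w)))).
    - exact: (cvgM aL (cvg_dot vl (dl w))).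
    - exact: (cvgD (cvgM acl f'l) (cvgM (cst _) (cvg_dot d'l d'l))).
    - exact: (cvgM aL (cvg_dot vl d'l)).
  rewrite !dotx0 !mulr0 !addr0 in el; apply: (cvgr_to_ge el).
  apply: nearW => t; have [gt Ct _ _ [at0 tr]] := H t.
  have gt0 : 0 < g (x t) by rewrite lt_def gt g0.
  have [_ le] := ampda_trial_le at0 gt0 Ct tr.
  by rewrite subr_ge0; exact: le.
(* The definition of [vs] makes the required sum zero; [key] divided by [al] is the quadratic
   minorant behind the Fréchet subgradient [- vs]. *)
split => //; exists (- vs), ys, zs; split.
- apply: (@frechet_subdiff_quadratic _ _ (fun t => 1 / g xs * f t) _
    (2^-1 / al)) => //.
    by rewrite divr_ge0// ltW.
  move=> w Cw; rewrite dotNl opprK -(ler_pM2l al0) -/c.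
  have -> : al * - (2^-1 / al * dot (w - xs) (w - xs)) =
      - (2^-1 * dot (w - xs) (w - xs)) by field; rewrite gt_eqF.
  by have := key w Cw; lra.
- by apply: (subdiff_closed gc xl yl) => t; have [] := H t.
- by apply: (subdiff_closed h2c xl zl) => t; have [] := H t.
- by rewrite /vs; apply/rowP => i; rewrite !mxE -/c; ring.
Qed.

Theorem theorem10 (R : realType) (n : nat)
    (f g h h1 h2 : 'rV[R]_n -> R) (C : set 'rV[R]_n)
    (f_ge0 : forall x, 0 <= f x) (g_ge0 : forall x, 0 <= g x)
    (f_lsc : lower_semicontinuous (fun x => (f x)%:E))
    (g_lsc : lower_semicontinuous (fun x => (g x)%:E))
    (h_lsc : lower_semicontinuous (fun x => (h x)%:E))
    (C_closed : closed C)
    (C_Omega : C `&` Omega g !=set0)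
    (f_lip : locally_lipschitz_on (Omega g) f)
    (g_convex : convex_on_Rn g)
    (h_eq : forall x, h x = h1 x - h2 x)
    (h1_smooth : locally_lipschitz_differentiable_on (Omega g) h1)
    (h2_convex : convex_on_Rn h2)
    (alo ahi sigma gamma : R)
    (alo_gt0 : 0 < alo) (alo_ahi : alo <= ahi)
    (sigma_gt0 : 0 < sigma) (gamma_gt0 : 0 < gamma) (gamma_lt1 : gamma < 1)
    (x0 : 'rV[R]_n) (x0_dom : edom (objective f g h C) x0)
    (x : nat -> 'rV[R]_n)
    (x_run : ampda_sequence f g h h1 h2 C alo ahi sigma gamma x0 x)
    (X_compact : compact (level_set (objective f g h C) x0))
    (xs : 'rV[R]_n) (xs_acc : cluster (x @ \oo) xs) :
  level_set (objective f g h C) x0 xs /\ critical_point f g h1 h2 C xs.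
Proof.
have desc := ampda_descent f_ge0 g_ge0 h_eq alo_gt0 gamma_gt0 gamma_lt1 x0_dom
  x_run.
have [x0E run] := x_run.
pose v k := f (x k) / g (x k) + h (x k).
have objE w : Omega g w -> C w -> objective f g h C w = (f w / g w + h w)%:E.
  by move=> gw Cw; rewrite /objective mem_set.
have vdec k : v k.+1 <= v k.
  have [_ _] := desc k; apply: le_trans; rewrite lerDl mulr_ge0 ?dotxx_ge0//.
  by rewrite divr_ge0// ltW.
have v0 k : v k <= v 0%N.
  by elim: k => // k; exact: le_trans.
have inX k : level_set (objective f g h C) x0 (x k).
  have [g0 C0 _] := desc 0%N; have [gk Ck _] := desc k.
  rewrite /level_set /= /edom /= -x0E !objE// ltry; split => //.
  by rewrite lee_fin; exact: v0.
have [U [UU oU xU]] := cluster_ultra xs_acc.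
have Xs : level_set (objective f g h C) x0 xs.
  apply: (@closed_cvg _ _ U _ x (level_set _ x0) _ _ xs xU).
    exact: compact_closed.
  by apply: nearW => k; exact: inX.
split => //.
have [gxs Cxs] : Omega g xs /\ C xs.
  move: Xs => [+ _]; rewrite /edom /= /objective; case: ifPn => [|_].
    by rewrite inE => -[].
  by rewrite ltxx.
(* As [f / g] is nonnegative, [h] minorizes the values, and its lower semicontinuity at [xs] bounds
   them below. *)
have cv : cvgn v.
  apply: (cvg_values_of_descent h_lsc xs_acc vdec) => k.
  by rewrite /v lerDr divr_ge0.
have dU : (fun k => x k.+1 - x k) @ U --> (0 : 'rV[R]_n).
  have s20 : 0 < sigma / 2 by rewrite divr_gt0.
  have dec k : v k.+1 + sigma / 2 * dot (x k.+1 - x k) (x k.+1 - x k) <= v k.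
    by have [] := desc k.
  by move=> A /(step_cvg0 s20 cv dec); exact: oU.
have x'U : (fun k => x k.+1) @ U --> xs.
  have -> : (fun k => x k.+1) = (fun k => x k + (x k.+1 - x k)).
    by apply/funext => k; rewrite subrKC.
  by rewrite -(addr0 xs); exact: cvgD.
have [p Hp] := choice (fun k =>
  ampda_step_spec alo_gt0 gamma_gt0 gamma_lt1 (run k)).
pose y k := (p k).1.1; pose z k := (p k).1.2; pose a k := (p k).2.
have {}Hp k : [/\ convex_subdiff g (x k) (y k), convex_subdiff h2 (x k) (z k),
    0 < a k <= ahi, ampda_trial f g h1 C (a k) (x k) (y k) (z k) (x k.+1) &
    alo <= a k \/ exists2 u,
      ampda_trial f g h1 C (a k / gamma) (x k) (y k) (z k) u &
      ~ ampda_accept f g h h1 h2 C sigma (x k) (y k) (z k) u].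
  by have := Hp k; rewrite /y /z /a; case: (p k) => [[? ?] ?] [? ? ? [? _] ?].
have [r [amin amin0 [r0 Hls]]] := line_search_near C f_ge0 g_ge0 f_lip g_convex
  h_eq h1_smooth h2_convex sigma_gt0 gxs.
have near_xs : U [set k | `|x k - xs| <= r].
  move/cvgrPdist_le : (xU) => /(_ _ r0); apply: filterS => k /=.
  by rewrite distrC.
(* A step size below [amin * gamma] would make the preceding trial size [a k / gamma] less than
   [amin], so near [xs] that trial could not have been rejected. *)
pose abar := Num.min alo (amin * gamma).
have abar0 : 0 < abar by rewrite lt_min alo_gt0 mulr_gt0.
have aU : U [set k | abar <= a k <= ahi].
  apply: filterS near_xs => k /= xk; have [yx zx /andP[a0 ->] _ la] := Hp k.
  rewrite andbT /abar ge_min; case: la => [->//|[u tru rej]].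
  apply/orP; right; rewrite leNgt; apply/negP => lt_a; apply: rej.
  have [_ Ck _] := desc k.
  apply: (Hls (a k / gamma)) => //; first by rewrite divr_gt0.
  by rewrite ler_pdivrMr// ltW.
have bounded_cvg (w : nat -> 'rV[R]_n) K :
    U [set k | `|w k| <= K] -> exists l : 'rV[R]_n, w @ U --> l.
  move=> wK; have [l _ wl] := ultra_compact_cvg UU (@compact_norm_le R n K) wK.
  by exists l.
have [ys yl] : exists l : 'rV[R]_n, y @ U --> l.
  have [K K0 HK] := subdiff_bounded xs g_convex r0.
  apply: (bounded_cvg _ K); apply: filterS near_xs => k /= xk.
  by have [yx _ _ _ _] := Hp k; exact: HK yx.
have [zs zl] : exists l : 'rV[R]_n, z @ U --> l.
  have [K K0 HK] := subdiff_bounded xs h2_convex r0.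
  apply: (bounded_cvg _ K); apply: filterS near_xs => k /= xk.
  by have [_ zx _ _ _] := Hp k; exact: HK zx.
have [al /andP[al1 _] aL] : exists2 l, abar <= l <= ahi & a @ U --> l.
  have [|l] := @ultra_compact_cvg _ _ U a `[abar, ahi]%classic UU
    (@segment_compact _ _ _).
    by apply: filterS aU => k /=; rewrite in_itv.
  by rewrite /= in_itv /=; exists l.
(* [f_lip] bounds [f] relative to [Omega g], which is a neighbourhood of [xs] by continuity of
   [g]. *)
have fc : {for xs, continuous f}.
  have [r2 r20 flip] := f_lip _ gxs; apply: lipschitz_continuous_at flip.
  apply: filterI; first exact: nbhsx_ballx.
  have gO : nbhs (g xs) [set t | t != 0] :=
    open_nbhs_nbhs (conj (@open_neq _ (0 : R)) gxs).
  exact: (convex_continuous g_convex gO).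
have h1c : {for xs, continuous (grad h1)}.
  by have [r3 r30 [_ gradc _]] := h1_smooth _ gxs; apply: gradc; exact: ballxx.
apply: (@critical_point_of_limit _ _ f g h1 h2 C _ U _ x (fun k => x k.+1)
  y z a xs ys zs al) => //; first exact: lt_le_trans al1.
move=> k; have [gk Ck _] := desc k; have [yx zx /andP[a0 _] tr _] := Hp k.
by [].
Qed.
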